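(* Let $I=[0,1]$ or $I=[0,\infty)$, let $X$ be a Banach function space on $I$, let $w:I\to(0,\infty)$ be a measurable weight, and let $T=\mathcal H_w$ or $T=\mathcal H_w^*$. Then the space $TX$ fails the fixed point property whenever it is nontrivial (i.e. $TX\ne\{0\}$).
   Context: $L^0(I)$ is the space of (a.e. equivalence classes of) real-valued Lebesgue measurable functions on $I$. A Banach function space $X$ on $I$ is a Banach space that is a linear subspace of $L^0(I)$ with the ideal property: $|f|\le|g|$ a.e., $f\in L^0(I)$, $g\in X$ imply $f\in X$ and $\|f\|_X\le\|g\|_X$; by convention $X$ is also assumed to contain a function positive a.e. on $I$ (this is not assumed for the derived space $TX$). $\mathcal H_wf(x)=w(x)\int_0^xf(t)\,dt$ and $\mathcal H_w^*f(x)=\int_{I\cap[x,\infty)}w(t)f(t)\,dt$ for $x\in I$. $TX=\{f\in L^0(I): T|f|\in X\}$ with norm $\|f\|_{TX}=\|T|f|\|_X$. A Banach space $E$ has the fixed point property if for every nonempty closed bounded convex $K\subset E$, every nonexpansive map $S:K\to K$ ($\|S(x)-S(y)\|\le\|x-y\|$ for all $x,y\in K$) has a fixed point. *)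

(* Defs.v *)
From HB Require Import structures.
From mathcomp Require Import all_boot all_order all_algebra generic_quotient.
From mathcomp Require Import all_classical all_reals all_analysis.
From mathcomp Require Import measurable_realfun.

Set Implicit Arguments.
Unset Strict Implicit.
Unset Printing Implicit Defensive.

Import Order.TTheory GRing.Theory Num.Theory.
Import numFieldNormedType.Exports.

Local Open Scope classical_set_scope.
Local Open Scope ring_scope.

(* The vector space of measurable functions modulo a.e. equality: the library
   has the quotient type, but not its algebraic structure. *)
Section L0_lmodule.
Context d (T : measurableType d) (R : realType).
Variable mu : {measure set T -> \bar R}.
Local Notation L0 := {mfun_ mu, T >-> R}.
Implicit Types (f g : L0) (u v : {mfun T >-> R}).
Local Open Scope quotient_scope.

Definition toL0 u : L0 := \pi u.

Lemma toL0_eq u v : toL0 u = toL0 v <-> {ae mu, forall x, u x = v x}.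
Proof.
split=> [/eqquotP /asboolP uv|uv].
  by apply: filterS uv => x; exact.
by apply/eqquotP/asboolP; apply: filterS uv => x + _.
Qed.

Lemma toL0K u : {ae mu, forall x, toL0 u x = u x}.
Proof. by apply/(toL0_eq (repr (toL0 u))); exact: reprK. Qed.

Lemma L0P f g : f = g <-> {ae mu, forall x, f x = g x}.
Proof. by rewrite -(toL0_eq (repr f) (repr g)) /toL0 !reprK. Qed.

Definition L0_zero : L0 := toL0 0.
Definition L0_opp f : L0 := toL0 (- repr f).
Definition L0_add f g : L0 := toL0 (repr f + repr g).
Definition L0_scale (a : R) f : L0 := toL0 (a *: repr f).

Let zeroE : {ae mu, forall x, L0_zero x = 0}.
Proof. exact: toL0K. Qed.
Let oppE f : {ae mu, forall x, L0_opp f x = - f x}.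
Proof. exact: toL0K. Qed.
Let addE f g : {ae mu, forall x, L0_add f g x = f x + g x}.
Proof. exact: toL0K. Qed.
Let scaleE a f : {ae mu, forall x, L0_scale a f x = a * f x}.
Proof. exact: toL0K. Qed.

Let filterS4 (P Q S U V : T -> Prop) :
  (forall x, P x -> Q x -> S x -> U x -> V x) ->
  {ae mu, forall x, P x} -> {ae mu, forall x, Q x} ->
  {ae mu, forall x, S x} -> {ae mu, forall x, U x} -> {ae mu, forall x, V x}.
Proof.
move=> H HP HQ HS HU; apply: filterS2 (filterI HP HQ) (filterI HS HU).
by move=> x [? ?] [? ?]; exact: H.
Qed.

Let addA : associative L0_add.
Proof.
move=> f g h; apply/L0P.
apply: filterS4 (addE f (L0_add g h)) (addE g h) (addE (L0_add f g) h)
  (addE f g) => x -> -> -> ->.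
by rewrite addrA.
Qed.

Let addC : commutative L0_add.
Proof.
move=> f g; apply/L0P.
by apply: filterS2 (addE f g) (addE g f) => x -> ->; rewrite addrC.
Qed.

Let add0 : left_id L0_zero L0_add.
Proof.
move=> f; apply/L0P.
by apply: filterS2 (addE L0_zero f) zeroE => x -> ->; rewrite add0r.
Qed.

Let addN : left_inverse L0_zero L0_opp L0_add.
Proof.
move=> f; apply/L0P.
apply: filterS3 (addE (L0_opp f) f) (oppE f) zeroE => x -> -> ->.
by rewrite addNr.
Qed.

HB.instance Definition _ := GRing.isZmodule.Build L0 addA addC add0 addN.

Let scaleA a b f : L0_scale a (L0_scale b f) = L0_scale (a * b) f.
Proof.
apply/L0P; apply: filterS3 (scaleE a (L0_scale b f)) (scaleE (a * b) f)
  (scaleE b f) => x -> -> ->.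
by rewrite mulrA.
Qed.

Let scale1 : left_id 1 L0_scale.
Proof.
by move=> f; apply/L0P; apply: filterS (scaleE 1 f) => x ->; rewrite mul1r.
Qed.

Let scaleDr : right_distributive L0_scale +%R.
Proof.
move=> a f g; apply/L0P.
apply: filterS4 (scaleE a (f + g)) (addE f g) (addE (L0_scale a f)
  (L0_scale a g)) (filterI (scaleE a f) (scaleE a g)) => x -> -> -> [-> ->].
by rewrite mulrDr.
Qed.

Let scaleDl f : {morph L0_scale^~ f : a b / a + b}.
Proof.
move=> a b; apply/L0P.
apply: filterS4 (scaleE (a + b) f) (addE (L0_scale a f) (L0_scale b f))
  (scaleE a f) (scaleE b f) => x -> -> -> ->.
by rewrite mulrDl.
Qed.

HB.instance Definition _ := GRing.Zmodule_isLmodule.Build R L0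
  scaleA scale1 scaleDr scaleDl.

Lemma L0_zeroE : {ae mu, forall x, (0 : L0) x = 0}.
Proof. exact: zeroE. Qed.
Lemma L0_oppE f : {ae mu, forall x, (- f : L0) x = - f x}.
Proof. exact: oppE. Qed.
Lemma L0_addE f g : {ae mu, forall x, (f + g : L0) x = f x + g x}.
Proof. exact: addE. Qed.
Lemma L0_scaleE a f : {ae mu, forall x, (a *: f : L0) x = a * f x}.
Proof. exact: scaleE. Qed.

End L0_lmodule.

(* The real line with the sigma-algebra of Lebesgue (not merely Borel)
   measurable sets, and Lebesgue measure on it. *)
Definition lebR (R : realType) : Type :=
  caratheodory_type (@wlength R idfun)^*%mu.
HB.instance Definition _ (R : realType) := Measurable.on (lebR R).

Definition leb (R : realType) : set (lebR R) -> \bar R :=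
  @completed_lebesgue_measure R.
HB.instance Definition _ (R : realType) := Measure.on (@leb R).
HB.instance Definition _ (R : realType) := SigmaFiniteMeasure.on (@leb R).

Lemma measurable_lebR (R : realType) (A : set R) :
  measurable A -> measurable (A : set (lebR R)).
Proof. exact: sub_caratheodory. Qed.

Lemma leb_lebesgue_measure (R : realType) (A : set R) :
  @leb R A = lebesgue_measure A.
Proof. by []. Qed.

(* The two admissible choices of the interval I *)
Variant domain := unit_interval | half_line.

Definition dom (R : realType) (i : domain) : set (lebR R) :=
  match i with
  | unit_interval => `[0%R, 1%R]
  | half_line => `[0%R, +oo[
  end.
Arguments dom : clear implicits.

Lemma measurable_dom (R : realType) (i : domain) : measurable (dom R i).
Proof. by case: i; apply: measurable_lebR; exact: measurable_itv. Qed.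

Definition leb_on (R : realType) (i : domain) : set (lebR R) -> \bar R :=
  mrestr (@leb R) (@measurable_dom R i).
HB.instance Definition _ (R : realType) i := Measure.on (@leb_on R i).

(* A measurable function on I is represented by a measurable function on the
   whole line, two of them being identified when they agree a.e. on I. *)
Notation L0 R i := {mfun_ (@leb_on R i), lebR R >-> R}.

Lemma ae_leb_onP (R : realType) (i : domain) (P : lebR R -> Prop) :
  {ae @leb_on R i, forall x, P x} <->
  {ae @leb R, forall x, dom R i x -> P x}.
Proof.
suff H (A : set (lebR R)) :
    (@leb_on R i).-negligible A <-> (@leb R).-negligible (A `&` dom R i).
  split=> [/H|HP].
    apply: negligibleS => x /= /not_implyP[Ix nPx].
    by split.
  by apply/H; apply: negligibleS HP => x /= [nPx Ix] /(_ Ix).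
have mI := @measurable_dom R i.
split=> [[B [mB B0 AB]]|[B [mB B0 AB]]].
  by exists (B `&` dom R i); split => //; [exact: measurableI|exact: setSI].
exists (B `|` ~` dom R i); split.
- by apply: measurableU => //; exact: measurableC.
- rewrite /leb_on /mrestr setIUl setICl setU0.
  apply/eqP; rewrite eq_le measure_ge0 andbT -B0.
  by apply: le_measure; rewrite ?inE//; exact: measurableI.
- move=> x Ax; case: (pselect (dom R i x)) => Ix; [left|by right].
  exact: AB.
Qed.

(* A Banach function space is given as an abstract Banach space together with
   its (injective, linear) inclusion into L^0(I). *)
Record banach_function_space (R : realType) (i : domain) :=
  BanachFunctionSpace {
  bfs_space :> completeNormedModType R;
  bfs_incl : {linear bfs_space -> L0 R i};
  bfs_incl_inj : injective bfs_incl;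
  bfs_ideal : forall (f : L0 R i) (g : bfs_space),
    {ae @leb_on R i, forall x, `|f x| <= `|(bfs_incl g : L0 R i) x|} ->
    exists2 h : bfs_space, bfs_incl h = f & `|h| <= `|g|;
  bfs_positive : exists g : bfs_space,
    {ae @leb_on R i, forall x, 0 < (bfs_incl g : L0 R i) x}
}.

Arguments bfs_incl {R i} X : rename.

Record weight (R : realType) (i : domain) := Weight {
  weight_fun :> lebR R -> R;
  measurable_weight : measurable_fun (dom R i) weight_fun;
  weight_gt0 : forall x, dom R i x -> 0 < weight_fun x
}.

Variant hardy_op := Hardy | HardyAdj.

(* Values in \bar R, since the integrals may diverge; below it is only applied
   to nonnegative f. *)
Definition hardy (R : realType) (i : domain) (T : hardy_op) (w f : lebR R -> R)
    (x : lebR R) : \bar R :=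
  match T with
  | Hardy => ((w x)%:E * \int[@leb R]_(t in `[0%R, x]) (f t)%:E)%E
  | HardyAdj => (\int[@leb R]_(t in dom R i `&` `[x, +oo[) (w t * f t)%:E)%E
  end.

Section hardy_theory.
Context (R : realType) (i : domain) (w : weight R i).
Implicit Types (f g : L0 R i) (T : hardy_op).
Local Notation mu := (@leb R).
Local Notation I := (dom R i).
Local Open Scope ereal_scope.

Let kdom T (x : lebR R) : set (lebR R) :=
  if T is Hardy then `[0%R, x] else I `&` `[x, +oo[.
Let k T (t : lebR R) : R := if T is Hardy then 1%R else w t.
Let c T (t : lebR R) : R := if T is Hardy then w t else 1%R.
Let J T f x := \int[mu]_(t in kdom T x) (k T t * `|f t|)%:E.

Let hardyJ T f x : hardy i T w (fun t => `|f t|%R) x = (c T x)%:E * J T f x.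
Proof.
rewrite /hardy /J /c /k; case: T => /=; last by rewrite mul1e.
by congr (_ * _); apply: eq_integral => t _; rewrite mul1r.
Qed.

Let kdom_sub T x : I x -> kdom T x `<=` I.
Proof.
case: T => [/=|_ t []//]; case: i => /=; rewrite !in_itv/=.
  move=> /andP[x0 x1] t /=; rewrite !in_itv/= => /andP[-> /le_trans]; exact.
by move=> _ t /=; rewrite !in_itv/= => /andP[->].
Qed.

Let mkdom T x : measurable (kdom T x).
Proof.
case: T => /=; first by apply: measurable_lebR; exact: measurable_itv.
apply: measurableI; first exact: measurable_dom.
by apply: measurable_lebR; exact: measurable_itv.
Qed.

Let mk T : measurable_fun I (k T).
Proof. by case: T => /=; [exact: measurable_cst|exact: measurable_weight]. Qed.

Let mc T : measurable_fun I (c T).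
Proof. by case: T => /=; [exact: measurable_weight|exact: measurable_cst]. Qed.

Let k_gt0 T x : I x -> (0 < k T x)%R.
Proof. by case: T => //=; exact: weight_gt0. Qed.

Let c_gt0 T x : I x -> (0 < c T x)%R.
Proof. by case: T => //=; exact: weight_gt0. Qed.

Let F T f t := (k T t * `|f t|)%:E.

Let mfun_L0 f (D : set (lebR R)) : measurable_fun D (f : lebR R -> R).
Proof. by apply: measurable_funTS; exact: (@measurable_funPT _ _ _ _ (repr f)). Qed.

Let mF T f : measurable_fun I (F T f).
Proof.
apply/measurable_EFinP.
apply: measurable_funM.
  exact: mk.
apply: measurableT_comp.
  exact: normr_measurable.
exact: mfun_L0.
Qed.

Let mFk T f x : I x -> measurable_fun (kdom T x) (F T f).
Proof. move=> Ix; apply: measurable_funS (mF T f) => //; last exact: kdom_sub.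
exact: measurable_dom. Qed.

Let F_ge0 T f t : I t -> 0 <= F T f t.
Proof. by move=> It; rewrite lee_fin mulr_ge0// ltW// k_gt0. Qed.

Let J_ge0 T f x : I x -> 0 <= J T f x.
Proof.
by move=> Ix; apply: integral_ge0 => t /(kdom_sub Ix) It; exact: F_ge0.
Qed.

Let J_le T f g x : I x ->
  {ae @leb_on R i, forall t, `|f t| <= `|g t|}%R -> J T f x <= J T g x.
Proof.
move=> Ix /ae_leb_onP fg; apply: ae_ge0_le_integral.
- exact: mkdom.
- by move=> t /(kdom_sub Ix) It; exact: F_ge0.
- exact: mFk.
- by move=> t /(kdom_sub Ix) It; exact: F_ge0.
- exact: mFk.
- apply: filterS fg => t + /(kdom_sub Ix) It => /(_ It) ftgt.
  by rewrite lee_fin ler_wpM2l// ltW// k_gt0.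
Qed.

Let J_add T f g x : I x -> J T (f + g)%R x <= J T f x + J T g x.
Proof.
move=> Ix; rewrite /J -ge0_integralD; last 5 first.
- exact: mkdom.
- by move=> t /(kdom_sub Ix) It; exact: F_ge0.
- exact: mFk.
- by move=> t /(kdom_sub Ix) It; exact: F_ge0.
- exact: mFk.
apply: ae_ge0_le_integral.
- exact: mkdom.
- by move=> t /(kdom_sub Ix) It; exact: F_ge0.
- exact: mFk.
- by move=> t /(kdom_sub Ix) It; rewrite adde_ge0//; exact: F_ge0.
- by apply: emeasurable_funD; exact: mFk.
have /ae_leb_onP := L0_addE f g.
apply: filterS => t + /(kdom_sub Ix) It => /(_ It) ->.
by rewrite lee_fin -mulrDr ler_wpM2l ?ler_normD// ltW// k_gt0.
Qed.

Let J_scale T (a : R) f x : I x -> J T (a *: f)%R x = `|a|%:E * J T f x.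
Proof.
move=> Ix; rewrite /J -ge0_integralZl; last 4 first.
- exact: mkdom.
- exact: mFk.
- by move=> t /(kdom_sub Ix) It; exact: F_ge0.
- by rewrite lee_fin.
apply: ge0_ae_eq_integral.
- exact: mkdom.
- exact: mFk.
- by apply: measurable_funeM; exact: mFk.
- by move=> t /(kdom_sub Ix) It; exact: F_ge0.
- by move=> t /(kdom_sub Ix) It; rewrite mule_ge0//; exact: F_ge0.
have /ae_leb_onP := L0_scaleE a f.
apply: filterS => t + /(kdom_sub Ix) It => /(_ It) ->.
by rewrite -EFinM normrM mulrCA.
Qed.

Let F_ge0' T f x t : I x -> kdom T x t -> 0 <= F T f t.
Proof. by move=> Ix /(kdom_sub Ix); exact: F_ge0. Qed.

(* [x] comes before [y] in the order along which [kdom T] increases *)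
Let before T (x y : R) := (if T is Hardy then x <= y else y <= x)%R.

Let kdom_before T x y : before T x y -> kdom T x `<=` kdom T y.
Proof.
case: T => /= xy t; first by rewrite /= !in_itv/= => /andP[-> /le_trans]; exact.
by move=> [It]; rewrite /= !in_itv/= !andbT => xt; split => //; apply: le_trans xt.
Qed.

Let J_before T f x y : I x -> I y -> before T x y -> J T f x <= J T f y.
Proof.
move=> Ix Iy xy; apply: ge0_subset_integral.
- exact: mkdom.
- exact: mkdom.
- exact: mFk.
- by move=> t; exact: F_ge0'.
- exact: kdom_before.
Qed.

Let dom_itv (x y z : lebR R) : I x -> I y -> (x <= z <= y)%R -> I z.
Proof.
case: i => /=; rewrite !in_itv/= => /andP[x0 x1] /andP[y0 y1] /andP[xz zy].
  by rewrite (le_trans x0)// (le_trans zy).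
by rewrite (le_trans x0).
Qed.

Let mJ T f : measurable_fun I (J T f).
Proof.
apply: (measurability _ (ErealGenOInfty.measurableE R)) => /=.
move=> _ [_ [r ->] <-]; apply: measurable_lebR.
apply: is_interval_measurable => s t /= [Is rs] [It rt] u sut.
have Iu : I u by exact: dom_itv sut.
move: sut rs rt => /andP[su ut].
rewrite 2!in_itv !andbT => rs rt; split; first exact: Iu.
rewrite /= in_itv andbT /=.
case: T rs rt => rs rt; [apply: (lt_le_trans rs)|apply: (lt_le_trans rt)];
  exact: J_before.
Qed.

Lemma measurable_hardy T f :
  measurable_fun I (hardy i T w (fun t => `|f t|%R)).
Proof.
rewrite (_ : hardy _ _ _ _ = (fun x => (c T x)%:E) \* J T f); last first.
  by apply/funext => x; rewrite hardyJ.
apply: emeasurable_funM; last exact: mJ.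
by apply/measurable_EFinP; exact: mc.
Qed.

Lemma hardy_ge0 T f x : I x -> 0 <= hardy i T w (fun t => `|f t|%R) x.
Proof.
by move=> Ix; rewrite hardyJ mule_ge0 ?J_ge0// lee_fin ltW// c_gt0.
Qed.

Lemma hardy_le T f g x : I x ->
  {ae @leb_on R i, forall t, `|f t| <= `|g t|}%R ->
  hardy i T w (fun t => `|f t|%R) x <= hardy i T w (fun t => `|g t|%R) x.
Proof.
by move=> Ix fg; rewrite !hardyJ lee_pmul2l ?lte_fin ?c_gt0// J_le.
Qed.

Lemma hardy_add T f g x : I x ->
  hardy i T w (fun t => `|(f + g : L0 R i)%R t|%R) x <=
  hardy i T w (fun t => `|f t|%R) x + hardy i T w (fun t => `|g t|%R) x.
Proof.
move=> Ix; rewrite !hardyJ -ge0_muleDr ?J_ge0// lee_pmul2l ?lte_fin ?c_gt0//.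
exact: J_add.
Qed.

Lemma hardy_scale T (a : R) f x : I x ->
  hardy i T w (fun t => `|(a *: f : L0 R i)%R t|%R) x =
  `|a|%:E * hardy i T w (fun t => `|f t|%R) x.
Proof. by move=> Ix; rewrite !hardyJ J_scale// muleCA. Qed.

Let dense T (x y : R) : ~ before T y x ->
  exists q : rat, before T x (ratr q) /\ before T (ratr q) y.
Proof.
case: T => /= /negP; rewrite -ltNge => /rat_in_itvoo[q]; rewrite in_itv/=;
  by move=> /andP[? ?]; exists q; split; exact: ltW.
Qed.

Lemma hardy_eq0 T f :
  {ae @leb_on R i, forall x, hardy i T w (fun t => `|f t|%R) x = 0} -> f = 0%R.
Proof.
move=> /ae_leb_onP Hf0; apply/L0P.
pose S : set (lebR R) := [set x | I x /\ J T f x = 0].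
have aeS : {ae mu, forall x, I x -> S x}.
  apply: filterS Hf0 => x + Ix => /(_ Ix); rewrite hardyJ => /eqP.
  by rewrite mule_eq0 eqe gt_eqF ?c_gt0//= => /eqP.
pose P (q : rat) (t : lebR R) := (exists2 y, S y & before T (ratr q) y) ->
  I t -> before T t (ratr q) -> f t = 0%R.
have aeP n : {ae mu, forall t, if unpickle n is Some q then P q t else True}.
  case: (unpickle n) => [q|]; last exact: aeW.
  case: (pselect (exists2 y, S y & before T (ratr q) y)) => [[y Sy qy]|nq];
    last by apply: aeW => t /nq.
  have [Iy Jy0] := Sy.
  have : \int[mu]_(t in kdom T y) `|F T f t| = 0.
    rewrite -[RHS]Jy0; apply: eq_integral => t; rewrite inE => kt.
    by rewrite gee0_abs// (@F_ge0' T f y t Iy kt).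
  move=> /(ae_eq_integral_abs mu (mkdom T y) (@mFk T f y Iy)).
  apply: filterS => t + _ It tq.
  have kt : kdom T y t.
    apply: (kdom_before qy).
    case: T tq {aeS P Sy qy Jy0 Hf0 S} => /= tq.
      by rewrite in_itv/= tq andbT; case: i It => /=; rewrite in_itv/= => /andP[].
    by split => //; rewrite /= in_itv/= tq.
  move=> /(_ kt) [] /eqP; rewrite mulf_eq0 gt_eqF ?k_gt0//= normr_eq0.
  by move=> /eqP.
have aeB : {ae mu, forall t, ~ (S t /\ forall y, S y -> before T y t)}.
  set B := [set t | S t /\ forall y, S y -> before T y t].
  have [[b [Sb bB]]|nB] := pselect (exists b, B b); last first.
    by apply: aeW => t Bt; apply: nB; exists t.
  exists [set b]; split.
  - by apply: measurable_lebR; exact: measurable_set1.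
  - by rewrite leb_lebesgue_measure lebesgue_measure_set1.
  - move=> t /= /contrapT[St tB]; apply/eqP; rewrite eq_le.
    have := bB _ St; have := tB _ Sb; rewrite /before.
    by case: (T) => -> ->.
have /ae_leb_onP aeZ := @L0_zeroE _ _ _ (@leb_on R i).
apply/ae_leb_onP; move/ae_foralln : aeP => aeP.
apply: filterS2 aeS (filterI aeP (filterI aeB aeZ)).
move=> t + [Pt [nBt Zt]] It => /(_ It) St; rewrite Zt//.
have [y Sy nyt] : exists2 y, S y & ~ before T y t.
  apply: contrapT => H; apply: nBt; split => // y Sy.
  by apply: contrapT => nyt; apply: H; exists y.
have [q [tq qy]] := dense nyt.
have := Pt (pickle q); rewrite pickleK; apply => //.
by exists y.
Qed.

End hardy_theory.

Section TX.
Context (R : realType) (i : domain).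
Variables (X : banach_function_space R i) (T : hardy_op) (w : weight R i).
Implicit Types (f : L0 R i) (g : X).
Local Notation incl g := (bfs_incl X g : L0 R i).
Local Notation Tabs f := (hardy i T w (fun t => `|f t|)).

(* T|f|, which is pointwise defined with values in [0, +oo], is finite a.e. on
   I and its class is (the image in L^0(I) of) g. *)
Definition Tabs_is f g := {ae @leb_on R i, forall x, Tabs f x = (incl g x)%:E}.

Definition TX_pred : {pred L0 R i} := [pred f | `[< exists g, Tabs_is f g >]].

Record TX := MkTX { TX_val : L0 R i; TX_valP : TX_val \in TX_pred }.

Lemma TX_predP f : reflect (exists g, Tabs_is f g) (f \in TX_pred).
Proof. exact: asboolP. Qed.

Lemma Tabs_is_inj f g1 g2 : Tabs_is f g1 -> Tabs_is f g2 -> g1 = g2.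
Proof.
move=> fg1 fg2; apply: bfs_incl_inj; apply/L0P.
by apply: filterS2 fg1 fg2 => x -> [].
Qed.

Lemma Tabs_is_dominated f g :
  {ae @leb_on R i, forall x, Tabs f x <= (incl g x)%:E}%E ->
  exists2 h, Tabs_is f h & `|h| <= `|g|.
Proof.
move=> fg; pose u := (fine \o Tabs f) \_ (dom R i).
have mu : measurable_fun [set: lebR R] u.
  apply/(measurable_restrictT _ (@measurable_dom R i)).1.
  apply: measurableT_comp; first exact: fine_measurable.
  exact: measurable_hardy.
pose U : {mfun lebR R >-> R} := mfun_Sub (mem_set mu).
have UE : {ae @leb_on R i, forall x, Tabs f x = (u x)%:E /\ 0 <= u x <= incl g x}.
  apply/ae_leb_onP; move/ae_leb_onP : fg; apply: filterS => x + Ix => /(_ Ix).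
  have /= := hardy_ge0 w T f Ix; rewrite /u patchE mem_set//=.
  case: hardy => [r| |]//=; rewrite !lee_fin => r0 rg.
  by split => //; rewrite r0.
have uE := @toL0K _ _ _ (@leb_on R i) U.
have [h hU hg] : exists2 h : X, bfs_incl X h = toL0 (@leb_on R i) U & `|h| <= `|g|.
  apply: bfs_ideal; apply: filterS2 UE uE => x [_ /andP[u0 ug]] ->.
  by rewrite (ger0_norm u0) (le_trans ug)// ler_norm.
exists h => //; rewrite /Tabs_is hU.
by apply: filterS2 UE uE => x [-> _] ->.
Qed.

Lemma Tabs_is_scale a f g :
  Tabs_is f g -> Tabs_is (a *: f : L0 R i) (`|a| *: g).
Proof.
move=> fg; rewrite /Tabs_is linearZ/=.
have /ae_leb_onP gE := L0_scaleE `|a| (bfs_incl X g).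
apply/ae_leb_onP; move/ae_leb_onP : fg; apply: filterS2 gE.
by move=> x + + Ix => /(_ Ix) -> /(_ Ix) fg; rewrite hardy_scale// fg.
Qed.

Lemma Tabs_is_add f1 f2 g1 g2 : Tabs_is f1 g1 -> Tabs_is f2 g2 ->
  exists2 h, Tabs_is (f1 + f2 : L0 R i) h & `|h| <= `|g1 + g2|.
Proof.
move=> fg1 fg2; apply: Tabs_is_dominated; rewrite linearD/=.
have /ae_leb_onP gE := L0_addE (bfs_incl X g1) (bfs_incl X g2).
move/ae_leb_onP : fg1 => fg1; move/ae_leb_onP : fg2 => fg2.
apply/ae_leb_onP; apply: filterS3 gE fg1 fg2.
move=> x + + + Ix => /(_ Ix) -> /(_ Ix) fg1 /(_ Ix) fg2.
by rewrite (le_trans (hardy_add _ _ _ _ Ix))// fg1 fg2.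
Qed.

Lemma Tabs_is0 : Tabs_is 0 0.
Proof.
rewrite /Tabs_is linear0.
rewrite -[X in hardy _ _ _ X](_ : (fun t => `|(0 *: 0 : L0 R i) t|) = _);
  last by rewrite scale0r.
have /ae_leb_onP zE := @L0_zeroE _ _ _ (@leb_on R i).
apply/ae_leb_onP; apply: filterS zE => x + Ix => /(_ Ix) ->.
by rewrite hardy_scale// normr0 mul0e.
Qed.

Lemma TX_submod_closed : submod_closed TX_pred.
Proof.
split=> [|a f1 f2 /TX_predP[g1 fg1] /TX_predP[g2 fg2]].
  by apply/TX_predP; exists 0; exact: Tabs_is0.
apply/TX_predP; have [h hP _] := Tabs_is_add (Tabs_is_scale a fg1) fg2.
by exists h.
Qed.
HB.instance Definition _ :=
  GRing.isSubmodClosed.Build R (L0 R i) TX_pred TX_submod_closed.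

HB.instance Definition _ := [isSub for TX_val].
HB.instance Definition _ := [Choice of TX by <:].
HB.instance Definition _ := [SubChoice_isSubLmodule of TX by <:].

(* T|f| as an element of X *)
Definition Tabs_in (f : TX) : X := projT1 (cid (elimT (TX_predP _) (TX_valP f))).

Lemma Tabs_inP (f : TX) : Tabs_is (TX_val f) (Tabs_in f).
Proof. by rewrite /Tabs_in; case: cid. Qed.

Lemma Tabs_inE (f : TX) g : Tabs_is (TX_val f) g -> Tabs_in f = g.
Proof. exact/Tabs_is_inj/Tabs_inP. Qed.

Definition TX_norm (f : TX) : R := `|Tabs_in f|.

Lemma TX_normD (f1 f2 : TX) : TX_norm (f1 + f2) <= TX_norm f1 + TX_norm f2.
Proof.
have [h hP hle] := Tabs_is_add (Tabs_inP f1) (Tabs_inP f2).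
by rewrite {1}/TX_norm (Tabs_inE (f := f1 + f2) hP) (le_trans hle)// ler_normD.
Qed.

Lemma TX_normZ a (f : TX) : TX_norm (a *: f) = `|a| * TX_norm f.
Proof.
rewrite {1}/TX_norm (Tabs_inE (f := a *: f) (Tabs_is_scale a (Tabs_inP f))).
by rewrite normrZ normr_id.
Qed.

Lemma TX_norm_eq0 (f : TX) : TX_norm f = 0 -> f = 0.
Proof.
move=> /normr0_eq0 f0; apply/val_inj => /=; apply: (@hardy_eq0 _ _ w T).
have := Tabs_inP f; rewrite f0 /Tabs_is linear0.
by apply: filterS2 (@L0_zeroE _ _ _ (@leb_on R i)) => x -> ->.
Qed.

HB.instance Definition _ :=
  Lmodule_isNormed.Build R TX TX_normD TX_normZ TX_norm_eq0.

End TX.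

(* Only the restriction of S to K matters, so S is taken to be defined on E. *)
Definition fixed_point_property (R : realType) (E : normedModType R) :=
  forall K : set E, K !=set0 -> closed K -> bounded_set K -> convex_set K ->
  forall S : E -> E, (forall x, K x -> K (S x)) ->
    (forall x y, K x -> K y -> `|S x - S y| <= `|x - y|) ->
    exists2 x, K x & S x = x.

(* Main.v *)
Require Import Defs.
From mathcomp Require Import all_boot all_order all_algebra.
From mathcomp Require Import all_classical all_reals all_analysis.
From mathcomp Require Import measurable_realfun lra.

Set Implicit Arguments.
Unset Strict Implicit.
Unset Printing Implicit Defensive.

Import Order.TTheory GRing.Theory Num.Theory.
Import numFieldNormedType.Exports.

Local Open Scope classical_set_scope.
Local Open Scope ring_scope.

(** Write T|f|(x) = c(x) m_x(|f|), where m_x(|f|) is the integral of k|f| over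
    the points of I preceding x.  For the Hardy operator k = 1, c = w and the
    order is the usual one; for its adjoint k = w, c = 1 and the order is
    reversed.  With this reading both operators are treated at once, and the
    norm of TX only sees how much mass of |f| has been met before x.  Delaying
    mass, i.e. moving it forward along the order, can therefore only decrease
    T|f|, pointwise, and hence the norm.  This yields an exact nonexpansive
    right shift on a copy of the unit simplex of l^1.

    Let (F_n) be pairwise disjoint intervals of I, each preceding the next one,
    all of them after a point p and before a point b, let D be their union, and
    let K be the set of the nonnegative f in TX that vanish off D and have
    total mass int_D k f = 1.  The flow S replaces f by the step function S f
    for which k (S f) is constant on each F_n, with mass 0 on F_0 and, on
    F_(n+1), the mass that f has on F_n.

    - S maps K to K, and |S f - S g| carries on F_(n+1) at most the mass that
      |f - g| has on F_n; thus T|S f - S g| <= T|f - g| everywhere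
      ([transport_forward]) and S is nonexpansive ([flow_nonexpansive]).
    - A fixed point has mass 0 on F_0, then on F_1, and so on, against total
      mass 1 ([flow_fixed_point_free]).
    - K is nonempty and bounded because T|f| <= c 1_{x after p} for f in K, and
      this function is in X: a nonzero u in TX has T|u| >= e c after some
      point p of I ([prefactor_tail_dominated]), which can be taken distinct
      from the end points.
    - K is closed because T|f| >= c int_D k|f| at the points after b, and c
      cut down to these points is a nonzero element of X, so that the total mass
      is continuous on TX ([mass_bounded], [simplex_closed]). *)

(** * The direction of the operators *)

(** The order in which the operator meets the points of I. *)
Definition before (R : realType) (T : hardy_op) (x y : R) : bool :=
  if T is Hardy then x <= y else y <= x.

Definition predecessors (R : realType) (i : domain) (T : hardy_op) (x : R) :
    set (lebR R) :=
  dom R i `&` [set t | before T t x].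

Definition density (R : realType) (T : hardy_op) (w : lebR R -> R)
  (t : lebR R) : R := if T is Hardy then 1 else w t.

Definition prefactor (R : realType) (T : hardy_op) (w : lebR R -> R)
  (t : lebR R) : R := if T is Hardy then w t else 1.

Section order_direction.
Context (R : realType) (T : hardy_op).
Implicit Types x y z : R.

Lemma before_refl x : before T x x.
Proof. by rewrite /before; case: T. Qed.

Lemma before_trans y x z : before T x y -> before T y z -> before T x z.
Proof. by case: T => /=; [exact: le_trans|move=> yx zy; exact: le_trans yx]. Qed.

Lemma before_total x y : before T x y || before T y x.
Proof. by case: T; rewrite /= le_total. Qed.

End order_direction.

Lemma dom_between (R : realType) (i : domain) (x y z : R) :
  dom R i x -> dom R i y -> x <= z <= y -> dom R i z.
Proof.
case: i => /=; rewrite !in_itv/= => /andP[x0 x1] /andP[y0 y1] /andP[xz zy].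
  by rewrite (le_trans x0)// (le_trans zy).
by rewrite (le_trans x0).
Qed.

(** Intervals of positive length are not negligible. *)
Lemma ae_itv_ex (R : realType) (x y : R) (P : lebR R -> Prop) : x < y ->
  {ae @leb R, forall t, P t} -> exists2 t : R, x <= t <= y & P t.
Proof.
move=> xy [N [mN N0 PN]]; apply: contrapT => nP.
have : (@leb R `[x, y]%classic <= @leb R N)%E.
  apply: le_measure; rewrite ?inE; first last.
  - move=> t /=; rewrite in_itv/= => txy; apply: PN => /= Pt.
    by apply: nP; exists t.
  - exact: mN.
  - by apply: measurable_lebR; exact: measurable_itv.
rewrite N0 leb_lebesgue_measure lebesgue_measure_itv/= lte_fin xy -EFinD lee_fin.
by apply/negP; rewrite -ltNge subr_gt0.
Qed.

(** Excluding both 0 and 1 makes the argument uniform in the operator and the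
    interval: [p] is then not the last point of I for the order. *)
Lemma exists_after (R : realType) (i : domain) (T : hardy_op) (p : R) :
  dom R i p -> p != 0 -> p != 1 ->
  exists q : R, [/\ dom R i q, p != q & before T p q].
Proof.
case: T; case: i => /=; rewrite in_itv/= => /andP[p_ge0 p_le1] p0 p1.
- exists 1; rewrite in_itv/= lexx ler01; split => //.
- by exists (p + 1); rewrite in_itv/= andbT addr_ge0 ?lerDl// eq_sym addrC
    -subr_eq0 addrK oner_eq0.
- by exists 0; rewrite in_itv/= lexx ler01.
- by exists 0; rewrite in_itv/= lexx.
Qed.

Lemma midpoint_before (R : realType) (i : domain) (T : hardy_op) (p q : R)
    (b := (p + q) / 2) : dom R i p -> dom R i q -> before T p q -> p != q ->
  [/\ dom R i b, before T p b, before T b q, p != b & b != q].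
Proof.
move=> Ip Iq pq npq.
suff [bpb bbq pb bq] : [/\ before T p b, before T b q, p != b & b != q].
  split=> //; move: bpb bbq; case: (T) => /= pb' bq'.
    by apply: dom_between Ip Iq _; rewrite pb'.
  by apply: dom_between Iq Ip _; rewrite bq'.
move: pq; rewrite /before /b; case: T => pq.
  have {}pq : p < q by rewrite lt_neqAle npq.
  by have [pb bq] := midf_lt pq; rewrite !ltW// !lt_eqF.
have {}pq : q < p by rewrite lt_neqAle eq_sym npq.
by have [qb bp] := midf_lt pq; rewrite [p + q]addrC !ltW// !gt_eqF.
Qed.

(** * The mass of a function on a set *)

Section mass.
Context (R : realType) (i : domain) (w : weight R i) (T : hardy_op).
Implicit Types (f g h : L0 R i) (A B : set (lebR R)) (x : R).
Local Notation mu := (@leb R).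
Local Notation I := (dom R i).
Local Notation k := (density T w).
Local Notation c := (prefactor T w).
Local Notation reach := (predecessors i T).
Local Open Scope ereal_scope.

Definition mass A f := \int[mu]_(t in A) (k t * `|f t|)%:E.

Lemma density_gt0 t : I t -> (0 < k t)%R.
Proof. by rewrite /density; case: T => // /(weight_gt0 w). Qed.

Lemma prefactor_gt0 t : I t -> (0 < c t)%R.
Proof. by rewrite /prefactor; case: T => // /(weight_gt0 w). Qed.

Lemma measurable_density : measurable_fun I k.
Proof.
by rewrite /density; case: T; [exact: measurable_cst|exact: measurable_weight].
Qed.

Lemma measurable_prefactor : measurable_fun I c.
Proof.
by rewrite /prefactor; case: T; [exact: measurable_weight|exact: measurable_cst].
Qed.

Lemma measurable_L0 f A : measurable_fun A (f : lebR R -> R).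
Proof.
by apply: measurable_funTS; exact: (@measurable_funPT _ _ _ _ (repr f)).
Qed.

Lemma before_itv x :
  [set t | before T t x] = [set` if T is Hardy then `]-oo, x] else `[x, +oo[].
Proof. by case: T; apply/seteqP; split=> t /=; rewrite in_itv/= ?andbT. Qed.

Lemma measurable_reach x : measurable (reach x).
Proof.
apply: measurableI; first exact: measurable_dom.
by rewrite before_itv; apply: measurable_lebR; case: T; exact: measurable_itv.
Qed.

Lemma reach_dom x : reach x `<=` I. Proof. by move=> t []. Qed.

(** The common form of the two operators. *)
Lemma hardyE f x : I x ->
  hardy i T w (fun t => `|f t|%R) x = (c x)%:E * mass (reach x) f.
Proof.
rewrite /mass /hardy /density /prefactor /predecessors /before => Ix.
case: T => /=; last first.
  rewrite mul1e (_ : `[x, +oo[%classic = [set t | (x <= t)%R])//.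
  by apply/seteqP; split=> t /=; rewrite in_itv/= andbT.
rewrite (_ : `[0%R, x]%classic = I `&` [set t | (t <= x)%R]).
  by congr (_ * _); apply: eq_integral => t _; rewrite mul1r.
move: Ix; case: i => /=; rewrite in_itv/= => /andP[x0 x1];
    apply/seteqP; split=> t /=; rewrite !in_itv/=.
- by move=> /andP[-> tx]; rewrite (le_trans tx x1).
- by move=> [/andP[-> _] ->].
- by move=> /andP[-> ->].
- by move=> [/andP[-> _] ->].
Qed.

Lemma measurable_integrand f A : A `<=` I -> measurable_fun A
  (fun t => (k t * `|f t|)%:E).
Proof.
move=> AI; apply/measurable_EFinP; apply: measurable_funM.
  apply: measurable_funS AI measurable_density; exact: measurable_dom.
by apply: measurableT_comp; [exact: normr_measurable|exact: measurable_L0].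
Qed.

Lemma integrand_ge0 f t : I t -> 0 <= (k t * `|f t|)%:E.
Proof. by move=> It; rewrite lee_fin mulr_ge0// ltW// density_gt0. Qed.

Lemma mass_ge0 A f : A `<=` I -> 0 <= mass A f.
Proof. by move=> AI; apply: integral_ge0 => t /AI; exact: integrand_ge0. Qed.

Lemma mass_le A f (u : lebR R -> \bar R) : measurable A -> A `<=` I ->
  measurable_fun A u -> (forall t, A t -> 0 <= u t) ->
  {ae mu, forall t, A t -> (k t * `|f t|)%:E <= u t} ->
  mass A f <= \int[mu]_(t in A) u t.
Proof.
move=> mA AI ms s0 fs; apply: ae_ge0_le_integral.
- exact: mA.
- by move=> t /AI; exact: integrand_ge0.
- exact: measurable_integrand.
- exact: s0.
- exact: ms.
- exact: fs.
Qed.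

Lemma mass_eq A f (u : lebR R -> \bar R) : measurable A -> A `<=` I ->
  measurable_fun A u -> (forall t, A t -> 0 <= u t) ->
  {ae mu, forall t, A t -> (k t * `|f t|)%:E = u t} ->
  mass A f = \int[mu]_(t in A) u t.
Proof.
move=> mA AI ms s0 fs; apply: ge0_ae_eq_integral.
- exact: mA.
- exact: measurable_integrand.
- exact: ms.
- by move=> t /AI; exact: integrand_ge0.
- exact: s0.
- exact: fs.
Qed.

Lemma mass_set0 f : mass set0 f = 0.
Proof. exact: integral_set0. Qed.

Lemma mass_subset A B f : measurable A -> measurable B -> A `<=` B ->
  B `<=` I -> mass A f <= mass B f.
Proof.
move=> mA mB AB BI; apply: ge0_subset_integral.
- exact: mA.
- exact: mB.
- exact: measurable_integrand.
- by move=> t /BI; exact: integrand_ge0.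
- exact: AB.
Qed.

Lemma mass_bigcup (F : (set (lebR R))^nat) f :
  (forall n, measurable (F n)) -> (forall n, F n `<=` I) ->
  trivIset setT F -> mass (\bigcup_n F n) f = \sum_(n <oo) mass (F n) f.
Proof.
move=> mF FI tF; apply: ge0_integral_bigcup.
- exact: mF.
- by apply: measurable_integrand => t [n _] /FI.
- by move=> t [n _] /FI; exact: integrand_ge0.
- exact: tF.
Qed.

Lemma mass_triangle A f g : measurable A -> A `<=` I ->
  mass A f <= mass A g + mass A (f - g)%R.
Proof.
move=> mA AI; rewrite /mass -ge0_integralD; last 5 first.
- by [].
- by move=> t /AI; exact: integrand_ge0.
- exact: measurable_integrand.
- by move=> t /AI; exact: integrand_ge0.
- exact: measurable_integrand.
apply: mass_le.
- exact: mA.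
- exact: AI.
- by apply: emeasurable_funD; exact: measurable_integrand.
- by move=> t /AI At; rewrite adde_ge0// integrand_ge0.
have /ae_leb_onP := L0_addE f (- g)%R; have /ae_leb_onP := L0_oppE g.
apply: filterS2 => t + + /AI It => /(_ It) gE /(_ It) fgE.
rewrite lee_fin -mulrDr ler_pM2l ?density_gt0// fgE gE.
by rewrite -[leLHS](_ : `|g t + (f t - g t)| = _)%R ?ler_normD// addrC subrK.
Qed.

Lemma mass_opp A f : measurable A -> A `<=` I -> mass A (- f)%R = mass A f.
Proof.
move=> mA AI; apply: mass_eq.
- exact: mA.
- exact: AI.
- exact: measurable_integrand.
- by move=> t /AI; exact: integrand_ge0.
- have /ae_leb_onP fE := L0_oppE f.
  by apply: filterS fE => t + /AI It => /(_ It) ->; rewrite normrN.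
Qed.

Lemma mass_dist A f g : measurable A -> A `<=` I ->
  mass A f \is a fin_num -> mass A g \is a fin_num ->
  (`|fine (mass A f) - fine (mass A g)|)%:E <= mass A (f - g)%R.
Proof.
move=> mA AI ffin gfin.
have sub_le h h' : mass A h \is a fin_num -> mass A h' \is a fin_num ->
    (fine (mass A h) - fine (mass A h'))%:E <= mass A (h - h')%R.
  move=> hfin h'fin; rewrite EFinB !fineK// leeBlDl//.
  exact: mass_triangle.
have [d0|d0] := leP 0%R (fine (mass A f) - fine (mass A g))%R.
  by rewrite ger0_norm// sub_le.
rewrite ltr0_norm// opprB -(mass_opp (f - g)%R mA AI) opprB; exact: sub_le.
Qed.

(** On nonnegative functions the mass is affine, so that prescribing it gives a
    convex set. *)
Lemma mass_convex A f g (a b : R) : measurable A -> A `<=` I ->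
  (0 <= a)%R -> (0 <= b)%R ->
  {ae @leb_on R i, forall t, 0 <= f t}%R ->
  {ae @leb_on R i, forall t, 0 <= g t}%R ->
  mass A (a *: f + b *: g)%R = a%:E * mass A f + b%:E * mass A g.
Proof.
move=> mA AI a0 b0 /ae_leb_onP f0 /ae_leb_onP g0.
have F0 h t : A t -> 0 <= (k t * `|h t|)%:E by move=> /AI; exact: integrand_ge0.
rewrite /mass -!ge0_integralZl; last 8 first.
- exact: mA.
- exact: measurable_integrand.
- by move=> t; exact: F0.
- by rewrite lee_fin.
- exact: mA.
- exact: measurable_integrand.
- by move=> t; exact: F0.
- by rewrite lee_fin.
rewrite -ge0_integralD; last 5 first.
- exact: mA.
- by move=> t At; rewrite mule_ge0// F0.
- by apply: measurable_funeM; exact: measurable_integrand.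
- by move=> t At; rewrite mule_ge0// F0.
- by apply: measurable_funeM; exact: measurable_integrand.
apply: mass_eq.
- exact: mA.
- exact: AI.
- by apply: emeasurable_funD; apply: measurable_funeM; exact: measurable_integrand.
- by move=> t At; rewrite adde_ge0// mule_ge0// F0.
have /ae_leb_onP DE := L0_addE (a *: f)%R (b *: g)%R.
have /ae_leb_onP fE := L0_scaleE a f; have /ae_leb_onP gE := L0_scaleE b g.
apply: filterS3 DE (filterI fE gE) (filterI f0 g0) => t + [+ +] [+ +] /AI It.
move=> /(_ It) -> /(_ It) -> /(_ It) -> /(_ It) ft /(_ It) gt.
rewrite -!EFinM -EFinD; congr EFin.
by rewrite !ger0_norm ?addr_ge0// ?mulr_ge0//; lra.
Qed.

End mass.

(** * The norm of TX *)

Section space.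
Context (R : realType) (i : domain).
Context (X : banach_function_space R i) (T : hardy_op) (w : weight R i).
Local Notation I := (dom R i).
Local Notation c := (prefactor T w).
Local Notation reach := (predecessors i T).
Local Notation E := (TX X T w).
Local Notation incl g := (bfs_incl X g : L0 R i).
Local Notation mass := (mass w T).
Implicit Types (f : L0 R i) (g : X) (u : E).

(** The ideal property of X passes to TX through T. *)
Lemma TX_dominated f g :
  {ae @leb_on R i, forall x,
     hardy i T w (fun t => `|f t|%R) x <= (incl g x)%:E}%E ->
  exists2 u : E, TX_val u = f & `|u| <= `|g|.
Proof.
move=> /Tabs_is_dominated[h fh hg].
have fX : f \in TX_pred X T w by apply/TX_predP; exists h.
exists (MkTX fX) => //.
by rewrite -[`|MkTX fX|]/(TX_norm (MkTX fX)) /TX_norm (Tabs_inE (f := MkTX fX) fh).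
Qed.

Lemma TX_ideal f u :
  {ae @leb_on R i, forall t, `|f t| <= `|TX_val u t|} ->
  exists2 v : E, TX_val v = f & `|v| <= `|u|.
Proof.
move=> fu; apply: (@TX_dominated f (Tabs_in u)).
have /ae_leb_onP uE := Tabs_inP u; apply/ae_leb_onP.
by apply: filterS uE => x + Ix => /(_ Ix) <-; exact: hardy_le.
Qed.

Lemma Tabs_in_mass u :
  {ae @leb_on R i, forall x,
     ((c x)%:E * mass (reach x) (TX_val u) = (incl (Tabs_in u) x)%:E)%E}.
Proof.
have /ae_leb_onP uE := Tabs_inP u; apply/ae_leb_onP.
by apply: filterS uE => x + Ix => /(_ Ix) <-; rewrite hardyE.
Qed.

(** The norm of TX is monotone in the accumulated masses, hence in more than
    the modulus: mass may be displaced, provided it is only delayed. *)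
Lemma TX_mass_le f u :
  (forall x, I x -> mass (reach x) f <= mass (reach x) (TX_val u))%E ->
  exists2 v : E, TX_val v = f & `|v| <= `|u|.
Proof.
move=> fu; apply: (@TX_dominated f (Tabs_in u)).
have /ae_leb_onP uE := Tabs_in_mass u; apply/ae_leb_onP.
apply: filterS uE => x + Ix => /(_ Ix) <-; rewrite hardyE//.
by rewrite lee_pmul2l ?lte_fin ?prefactor_gt0// fu.
Qed.

Lemma mass_reach_le x y f : before T x y ->
  (mass (reach x) f <= mass (reach y) f)%E.
Proof.
move=> xy; apply: mass_subset.
- exact: measurable_reach.
- exact: measurable_reach.
- by move=> t [It tx]; split => //=; exact: before_trans xy.
- exact: reach_dom.
Qed.

(** If T|u| vanished at all points of I but 0 and 1, it would vanish a.e. and u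
    would be 0; so u has met a mass of at least some e > 0 at a point p that is
    not an end point, and the same holds after p, where T|u| >= e c. *)
Lemma prefactor_tail_dominated : (exists u : E, u != 0) ->
  exists p q : R, [/\ I p, I q, p != q, before T p q &
    exists g, {ae @leb_on R i, forall x,
      0 <= incl g x /\ (before T p x -> c x <= incl g x)}].
Proof.
move=> [u u0].
have [p [Ip [p0 p1] Jp]] : exists p : R, [/\ I p, p != 0 /\ p != 1 &
    (0 < mass (reach p) (TX_val u))%E].
  apply: contrapT => np; move: u0; rewrite (_ : u = 0) ?eqxx//.
  apply/val_inj => /=; apply: (@hardy_eq0 _ _ w T); apply/ae_leb_onP.
  exists [set (0 : R); (1 : R)]; split.
  - by apply: measurable_lebR; apply: measurableU; exact: measurable_set1.
  - have leb1 (a : R) : @leb R [set a] = 0%E.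
      by rewrite leb_lebesgue_measure lebesgue_measure_set1.
    apply/eqP; rewrite eq_le measure_ge0 andbT.
    have <- : (@leb R [set (0 : R)%R] + @leb R [set (1 : R)%R] = 0)%E by rewrite !leb1 adde0.
    by apply: measureU2; apply: measurable_lebR; exact: measurable_set1.
  move=> x /=; apply: contra_notP => /not_orP[/eqP x0 /eqP x1] Ix.
  rewrite hardyE//; apply/eqP; rewrite mule_eq0; apply/orP; right.
  rewrite eq_le mass_ge0 ?andbT; last exact: reach_dom.
  by rewrite leNgt; apply/negP => Jx; apply: np; exists x.
have [q [Iq pq bpq]] := exists_after T Ip p0 p1.
exists p, q; split => //.
have [e e0 eJ] : exists2 e : R, 0 < e & (e%:E <= mass (reach p) (TX_val u))%E.
  case: (mass _ _) Jp => [r||]//= r0; first by exists r.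
  (* the mass met at p may be infinite; any positive number bounds it below *)
  by exists 1; rewrite ?leey.
exists (e^-1 *: Tabs_in u).
have /ae_leb_onP uE := Tabs_in_mass u; apply/ae_leb_onP; rewrite linearZ/=.
have /ae_leb_onP sE := L0_scaleE e^-1 (bfs_incl X (Tabs_in u)).
apply: filterS2 uE sE => x + + Ix => /(_ Ix) uE /(_ Ix) ->.
have J0 : (0 <= mass (reach x) (TX_val u))%E by apply: mass_ge0; exact: reach_dom.
have c0 := prefactor_gt0 w T Ix.
split=> [|px].
  rewrite mulr_ge0 ?invr_ge0 ?(ltW e0)//.
  by rewrite -lee_fin -uE mule_ge0// lee_fin ltW.
rewrite ler_pdivlMl// mulrC -lee_fin -uE EFinM lee_pmul2l ?lte_fin//.
exact: le_trans eJ (mass_reach_le _ px).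
Qed.

(** Let h be the element of X equal to c after b and to 0 before b; it is nonzero
    since b precedes q strictly.  If m is the mass that u has met at b, then
    m h <= T|u|, whence m <= ||u|| / ||h||. *)
Lemma mass_bounded (p b q : R) g : I p -> I b -> I q ->
  before T p b -> before T b q -> b != q ->
  {ae @leb_on R i, forall x,
    0 <= incl g x /\ (before T p x -> c x <= incl g x)} ->
  exists2 C : R, 0 < C &
    forall u, (mass (reach b) (TX_val u) <= (C * `|u|)%:E)%E.
Proof.
move=> Ip Ib Iq pb bq nbq gP.
have ex_after (P : lebR R -> Prop) : {ae @leb_on R i, forall x, P x} ->
    exists x : R, [/\ I x, before T b x & P x].
  move=> /ae_leb_onP; move: bq; case: (T) => /= bq.
    have {}bq : b < q by rewrite lt_neqAle nbq.
    move=> /(ae_itv_ex bq)[x bxq Px]; exists x.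
    have Ix := dom_between Ib Iq bxq.
    by case/andP: bxq => ? ?; split => //; exact: Px.
  have {}bq : q < b by rewrite lt_neqAle eq_sym nbq.
  move=> /(ae_itv_ex bq)[x bxq Px]; exists x.
  have Ix := dom_between Iq Ib bxq.
  by case/andP: bxq => ? ?; split => //; exact: Px.
(* A is the set of the points after b, and U is c cut down to A *)
pose A : set (lebR R) := I `&` [set x | before T b x].
have mA : measurable A.
  apply: measurableI; first exact: measurable_dom.
  rewrite (_ : [set x | _] =
      [set` if T is Hardy then `[b, +oo[ else `]-oo, b]]).
    by apply: measurable_lebR; case: (T); exact: measurable_itv.
  by case: (T); apply/seteqP; split=> t /=; rewrite in_itv/= ?andbT.
have mc : measurable_fun setT (c \_ A).
  apply/(measurable_restrictT _ _).1; first exact: mA.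
  apply: measurable_funS (measurable_prefactor w T); first exact: measurable_dom.
  by move=> x [].
pose U : L0 R i := toL0 (@leb_on R i) (mfun_Sub (mem_set mc)).
have UE : {ae @leb_on R i, forall x, U x = (c \_ A) x}.
  exact: (@toL0K _ _ _ (@leb_on R i) (mfun_Sub (mem_set mc))).
have [h hU _] : exists2 h : X, bfs_incl X h = U & `|h| <= `|g|.
  apply: bfs_ideal; move/ae_leb_onP : gP => gP; move/ae_leb_onP : UE => UE.
  apply/ae_leb_onP; apply: filterS2 gP UE => x + + Ix.
  move=> /(_ Ix)[g0 gc] /(_ Ix) ->; rewrite (ger0_norm g0) patchE.
  case: ifPn => [/set_mem[_ bx]|_]; last by rewrite normr0.
  by rewrite ger0_norm ?(ltW (prefactor_gt0 _ _ _))// gc//; exact: before_trans bx.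
have h0 : 0 < `|h|.
  rewrite normr_gt0; apply/eqP => hz; rewrite hz linear0 in hU.
  have : {ae @leb_on R i, forall x, U x = (c \_ A) x /\ (0 : L0 R i) x = 0}.
    exact: filterI UE (@L0_zeroE _ _ _ (@leb_on R i)).
  move=> /ex_after[x [Ix bx]]; rewrite -hU => -[-> ] /eqP.
  by rewrite patchE mem_set// gt_eqF// prefactor_gt0.
exists `|h|^-1 => [|u]; first by rewrite invr_gt0.
have uE := Tabs_in_mass u; set M := mass _ _.
(* T|u| is finite a.e., hence at some point after b *)
have [m m0 ME] : exists2 m : R, 0 <= m & M = m%:E.
  have : (0 <= M)%E by apply: mass_ge0; exact: reach_dom.
  have [x [Ix bx xE]] := ex_after _ uE.
  have := mass_reach_le (TX_val u) bx; rewrite -/M.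
  case: M => [m|//|//]; first by rewrite lee_fin => _ m0; exists m.
  rewrite leye_eq => /eqP Mx; move: xE; rewrite Mx mulry.
  by rewrite gtr0_sg ?prefactor_gt0// mul1e.
have [h' h'U h'u] : exists2 h' : X, bfs_incl X h' = m *: U & `|h'| <= `|Tabs_in u|.
  apply: bfs_ideal; have sE := L0_scaleE m U.
  move/ae_leb_onP : uE => uE; move/ae_leb_onP : UE => UE.
  move/ae_leb_onP : sE => sE.
  apply/ae_leb_onP; apply: filterS3 uE UE sE => x + + + Ix.
  move=> /(_ Ix) uE /(_ Ix) UE /(_ Ix) ->; rewrite UE patchE.
  case: ifPn => [/set_mem[_ bx]|_]; last by rewrite mulr0 normr0.
  have c0 := prefactor_gt0 w T Ix.
  rewrite ger0_norm ?mulr_ge0 ?(ltW c0)//; apply: le_trans (ler_norm _).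
  rewrite -lee_fin -uE mulrC EFinM lee_pmul2l ?lte_fin// -ME.
  exact: mass_reach_le.
have h'E : h' = m *: h by apply: bfs_incl_inj; rewrite h'U linearZ/= hU.
rewrite ME lee_fin ler_pdivlMl// mulrC.
by move: h'u; rewrite h'E normrZ (ger0_norm m0).
Qed.

End space.

(** * Chains of intervals *)

(** [cell_order] is what makes the shift along the cells admissible: once a point
    of a cell has been met, the whole preceding cell has been met. *)
Record chain (R : realType) (i : domain) (T : hardy_op) (p b : R) := Chain {
  cell :> nat -> set (lebR R);
  len : nat -> R;
  measurable_cell : forall n, measurable (cell n);
  cell_disjoint : trivIset setT cell;
  len_gt0 : forall n, 0 < len n;
  leb_cell : forall n, @leb R (cell n) = (len n)%:E;
  cell_reach : forall n, cell n `<=` predecessors i T b;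
  cell_start : forall n t, cell n t -> before T p t;
  cell_order : forall n s t, cell n s -> cell n.+1 t -> before T s t
}.

(** The cells are cut by the points b + (p - b) / (n + 1), which go strictly from
    p towards b in the given order. *)
Lemma harmonic_chain (R : realType) (i : domain) (T : hardy_op) (p b : R) :
  dom R i p -> dom R i b -> before T p b -> p != b -> chain i T p b.
Proof.
move=> Ip Ib pb npb.
pose a n : R := b + (p - b) / n.+1%:R.
have a0 : a 0%N = p by rewrite /a divr1 addrC subrK.
have aS n : before T (a n) (a n.+1) && (a n != a n.+1).
  have lt_inv : (n.+2%:R^-1 < n.+1%:R^-1 :> R).
    by rewrite ltf_pV2 ?posrE ?ltr0n// ltr_nat.
  rewrite /a (inj_eq (addrI _)) (inj_eq (mulfI _)) ?subr_eq0// gt_eqF// andbT.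
  move: pb npb; case: (T) => /= pb npb; rewrite lerD2l.
    by rewrite ler_nM2l ?ltW// subr_lt0 lt_neqAle npb.
  by rewrite ler_pM2l ?ltW// subr_gt0 lt_neqAle eq_sym npb.
have a_mono m n : (m <= n)%N -> before T (a m) (a n).
  elim: n => [|n IHn]; first by rewrite leqn0 => /eqP ->; exact: before_refl.
  rewrite leq_eqVlt => /orP[/eqP ->|/IHn mn]; first exact: before_refl.
  by apply: before_trans mn _; case/andP: (aS n).
have ab n : before T (a n) b.
  rewrite /a; move: pb; case: (T) => /= pb.
    by rewrite gerDl mulr_le0_ge0// subr_le0.
  by rewrite lerDl mulr_ge0// subr_ge0.
pose F n : set (lebR R) := [set t | before T (a n) t /\ ~~ before T (a n.+1) t].
have Fnext n t : F n t -> before T t (a n.+1).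
  by move=> [_ nt]; have := before_total T t (a n.+1); rewrite (negbTE nt) orbF.
have FE n : F n =
    [set` if T is Hardy then `[a n, a n.+1[ else `]a n.+1, a n]].
  rewrite /F; case: (T); apply/seteqP; split=> t /=; rewrite in_itv/= -ltNge.
  - by move=> [-> ->].
  - by move=> /andP[-> ->].
  - by move=> [-> ->].
  - by move=> /andP[-> ->].
apply: (@Chain _ _ _ _ _ F (fun n => `|a n - a n.+1|)).
- move=> n; rewrite FE; apply: measurable_lebR.
  by case: (T); exact: measurable_itv.
- apply/trivIsetP => /= m n _ _; wlog mn : m n / (m < n)%N => [H mn|_].
    by have := mn; rewrite neq_ltn => /orP[|] ?; [|rewrite setIC]; apply: H;
      rewrite // eq_sym.
  rewrite -subset0 => t [[_ /negP nt] [nt' _]]; apply: nt.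
  exact: before_trans (a_mono _ _ mn) nt'.
- by move=> n; rewrite normr_gt0 subr_eq0; case/andP: (aS n).
- move=> n; rewrite leb_lebesgue_measure FE; case/andP: (aS n).
  case: (T) => /= le neq; rewrite lebesgue_measure_itv/= lte_fin.
    by rewrite lt_neqAle neq le/= -EFinD distrC ger0_norm// subr_ge0.
  by rewrite lt_neqAle eq_sym neq le/= -EFinD ger0_norm// subr_ge0.
- move=> n t Ft; have pt : before T p t.
    by case: Ft => + _; apply: before_trans; rewrite -a0; exact: a_mono.
  have tb : before T t b by exact: before_trans (Fnext _ _ Ft) (ab _).
  split => //; move: pt tb; case: (T) => /= pt tb.
    by apply: dom_between Ip Ib _; rewrite pt.
  by apply: dom_between Ib Ip _; rewrite tb.
- by move=> n t [+ _]; apply: before_trans; rewrite -a0; exact: a_mono.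
- by move=> n s t /Fnext sn [nt _]; exact: before_trans nt.
Qed.

(** * Step functions on a chain *)

(** [idx] is the index of the set containing the point; on each of the countably
    many sets the function is constant. *)
Lemma measurable_step d (U : measurableType d) (R : realType)
    (F : (set U)^nat) (r : nat -> R) :
  (forall n, measurable (F n)) -> trivIset setT F ->
  exists2 u : U -> R, measurable_fun setT u &
    (forall n x, F n x -> u x = r n) /\
    (forall x, ~ (\bigcup_n F n) x -> u x = 0).
Proof.
move=> mF tF; pose idx x := xget 0%N [set n | F n x].
have idxE n x : F n x -> idx x = n.
  move=> Fnx; apply: (tF _ _ I I); exists x; split => //.
  by rewrite /idx; case: xgetP => [m _ //|/(_ n)].
exists ((r \o idx) \_ (\bigcup_n F n)).
  apply/(measurable_restrictT _ _).1; first exact: bigcup_measurable.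
  apply/measurable_fun_bigcup => // n.
  apply: (eq_measurable_fun (cst (r n))); last exact: measurable_cst.
  by move=> x; rewrite inE => /idxE /= ->.
split=> [n x Fnx|x nFx]; last by rewrite patchE memNset.
by rewrite patchE mem_set /= ?(idxE n)//; exists n.
Qed.

Section step.
Context (R : realType) (i : domain) (w : weight R i) (T : hardy_op).
Context (p b : R) (ch : chain i T p b).
Local Notation mu := (@leb R).
Local Notation I := (dom R i).
Local Notation k := (density T w).
Local Notation D := (\bigcup_n cell ch n).
Local Notation mass := (mass w T).
Local Notation reach := (predecessors i T).
Implicit Types (f : L0 R i) (r s : nat -> R).

Lemma cell_dom n : ch n `<=` I.
Proof. by move=> t /cell_reach[]. Qed.

Lemma measurable_support : measurable D.
Proof. by apply: bigcup_measurable => n _; exact: measurable_cell. Qed.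

Lemma support_dom : D `<=` I.
Proof. by move=> t [n _] /cell_dom. Qed.

(** It is [k * f], not [f], that is constant on the cells: the masses are then
    determined by the lengths of the cells, and no integrability of [k] is
    involved. *)
Lemma exists_step r : exists f, {ae @leb_on R i, forall t,
  (forall n, ch n t -> k t * f t = r n) /\ (~ D t -> f t = 0)}.
Proof.
have [u mu_ [uE u0]] := measurable_step r (measurable_cell ch) (@cell_disjoint _ _ _ _ _ ch).
(* the power with exponent -1 is the inverse, with known measurability *)
pose v := (fun t => u t * (k t) `^ (-1)) \_ I.
have mv : measurable_fun setT v.
  apply/(measurable_restrictT _ (@measurable_dom R i)).1.
  apply: measurable_funM; first exact: measurable_funTS.
  apply: (measurableT_comp (measurable_powR (-1))).
  exact: measurable_density.
exists (toL0 (@leb_on R i) (mfun_Sub (mem_set mv))).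
have vE := @toL0K _ _ _ (@leb_on R i) (mfun_Sub (mem_set mv)).
move/ae_leb_onP : vE => vE; apply/ae_leb_onP.
apply: filterS vE => t + It => /(_ It) ->.
have k0 := density_gt0 w T It.
rewrite /= /v patchE mem_set//= powR_inv1 ?ltW//.
by split=> [n /uE ->|/u0 ->]; rewrite ?mul0r// mulrCA divff ?gt_eqF// mulr1.
Qed.

Definition step r : L0 R i := projT1 (cid (exists_step r)).

Lemma stepE r : {ae @leb_on R i, forall t,
  (forall n, ch n t -> k t * step r t = r n) /\ (~ D t -> step r t = 0)}.
Proof. by rewrite /step; case: cid. Qed.

Lemma step_ge0 r : (forall n, 0 <= r n) ->
  {ae @leb_on R i, forall t, 0 <= step r t}.
Proof.
move=> r0; have /ae_leb_onP rE := stepE r; apply/ae_leb_onP.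
apply: filterS rE => t + It => /(_ It)[rE re].
have [[n _ nt]|nD] := pselect (D t); last by rewrite re.
by rewrite -(pmulr_rge0 _ (density_gt0 w T It)) (rE n).
Qed.

Lemma step_sub r s : step (fun n => r n - s n) = step r - step s.
Proof.
have /ae_leb_onP rE := stepE r; have /ae_leb_onP sE := stepE s.
have /ae_leb_onP rsE := stepE (fun n => r n - s n).
have /ae_leb_onP addE := L0_addE (step r) (- step s).
have /ae_leb_onP oppE := L0_oppE (step s).
apply/L0P/ae_leb_onP; apply: filterS3 rsE (filterI rE sE) (filterI addE oppE).
move=> t + [+ +] [+ +] It.
move=> /(_ It)[rsD rs0] /(_ It)[rD r0] /(_ It)[sD s0] /(_ It) -> /(_ It) ->.
have [[n _ nt]|nD] := pselect (D t); last by rewrite rs0// r0// s0// subr0.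
apply: (mulfI (lt0r_neq0 (density_gt0 w T It))).
by rewrite (rsD n)// mulrBr (rD n)// (sD n).
Qed.

Lemma mass_step r n A : measurable A -> A `<=` cell ch n ->
  mass A (step r) = (`|r n|%:E * mu A)%E.
Proof.
move=> mA An; rewrite -integral_cst; last exact: mA.
have AI : A `<=` I by move=> t /An /cell_dom.
apply: mass_eq.
- exact: mA.
- exact: AI.
- exact: measurable_cst.
- by move=> t _; rewrite lee_fin.
have /ae_leb_onP rE := stepE r; apply: filterS rE => t + At.
move=> /(_ (AI _ At))[rE _]; rewrite -(rE n) ?normrM; last exact: An.
by rewrite gtr0_norm// (density_gt0 w T (AI _ At)).
Qed.

Lemma mass_cell_step r n : mass (ch n) (step r) = (`|r n| * len ch n)%:E.
Proof. by rewrite (@mass_step r n)// ?leb_cell//; exact: measurable_cell. Qed.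

Lemma mass_support f A : measurable A -> A `<=` I ->
  {ae @leb_on R i, forall t, ~ D t -> f t = 0} ->
  mass A f = (\sum_(n <oo) mass (A `&` ch n) f)%E.
Proof.
move=> mA AI /ae_leb_onP fD.
have mAn n : measurable (A `&` ch n).
  by apply: measurableI; [exact: mA|exact: measurable_cell].
rewrite -mass_bigcup; first last.
- exact: trivIset_setIl (@cell_disjoint _ _ _ _ _ ch).
- by move=> n t [/AI].
- exact: mAn.
rewrite -setI_bigcupr {2}/mass integral_mkcondr; apply: mass_eq.
- exact: mA.
- exact: AI.
- apply: (measurable_restrict _ measurable_support mA).1.
  by apply: measurable_integrand => t [/AI].
- move=> t At; rewrite patchE; case: ifP => // _.
  by apply: integrand_ge0; exact: AI.
- apply: filterS fD => t + /AI It => /(_ It) fD.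
  by rewrite patchE; case: ifPn => // /negP; rewrite inE => /fD ->;
    rewrite normr0 mulr0.
Qed.

Lemma mass_reach_support f x :
  {ae @leb_on R i, forall t, ~ D t -> f t = 0} ->
  mass (reach x) f = (\sum_(n <oo) mass (reach x `&` ch n) f)%E.
Proof.
by apply: mass_support; [exact: measurable_reach|exact: reach_dom].
Qed.

Lemma mass_D_support f :
  mass D f = (\sum_(n <oo) mass (ch n) f)%E.
Proof.
by rewrite mass_bigcup//;
  [exact: measurable_cell|exact: cell_dom|exact: cell_disjoint].
Qed.

(** Suppose that the step function carries on each cell at most the mass of [f]
    on the preceding cell.  When x is reached, any cell met by the step function
    is preceded by a cell that has been met entirely, so the mass of the step
    function met so far is compensated cell by cell by that of [f]. *)
Lemma transport_forward r f : r 0%N = 0 ->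
  (forall n, ((`|r n.+1| * len ch n.+1)%:E <= mass (ch n) f)%E) ->
  forall x, (mass (reach x) (step r) <= mass (reach x) f)%E.
Proof.
move=> r0 rf x.
have mxn n : measurable (reach x `&` ch n).
  by apply: measurableI; [exact: measurable_reach|exact: measurable_cell].
have xnI n : reach x `&` ch n `<=` I by move=> t [_ /cell_dom].
rewrite mass_reach_support; last by apply: filterS (stepE r) => t [].
rewrite nneseries_recl; last 2 first.
- by move=> n _; exact: mass_ge0.
- by [].
rewrite (@mass_step r 0%N) ?r0 ?normr0 ?mul0e ?add0e; last 2 first.
- exact: mxn.
- exact: subIsetr.
(* the cell n + 1 of the step function is compared with the cell n of f *)
rewrite -(nneseries_addn 1)//; last by move=> n; exact: mass_ge0.
apply: (@le_trans _ _ (mass (\bigcup_n (reach x `&` ch n)) f)); last first.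
  apply: mass_subset.
  - exact: bigcup_measurable.
  - exact: measurable_reach.
  - by move=> t [n _ []].
  - exact: reach_dom.
rewrite mass_bigcup; first last.
- exact: trivIset_setIl (@cell_disjoint _ _ _ _ _ ch).
- exact: xnI.
- exact: mxn.
apply: lee_nneseries => [n _ _|n _]; first exact: mass_ge0.
rewrite addn1.
have [[t [xt nt]]|nt] := pselect (exists t, (reach x `&` ch n.+1) t); last first.
  rewrite (_ : _ `&` _ = set0); last by rewrite -subset0 => t ?; apply: nt; exists t.
  by rewrite mass_set0 mass_ge0.
rewrite [in leRHS]setIidr; last first.
  move=> s ns; split; first exact: cell_dom ns.
  exact: before_trans (cell_order ns nt) (proj2 xt).
apply: le_trans (rf n); rewrite -mass_cell_step; apply: mass_subset.
- exact: mxn.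
- exact: measurable_cell.
- exact: subIsetr.
- exact: cell_dom.
Qed.

End step.

(** * The shift of the simplex *)

Section flow.
Context (R : realType) (i : domain).
Context (X : banach_function_space R i) (T : hardy_op) (w : weight R i).
Context (p b : R) (ch : chain i T p b) (g : X) (C : R).
Local Notation I := (dom R i).
Local Notation k := (density T w).
Local Notation c := (prefactor T w).
Local Notation reach := (predecessors i T).
Local Notation E := (TX X T w).
Local Notation D := (\bigcup_n cell ch n).
Local Notation mass := (mass w T).
Local Notation incl g := (bfs_incl X g : L0 R i).
Implicit Types (f : L0 R i) (u v h : E) (n : nat).

Context (tail_g : {ae @leb_on R i, forall x,
  0 <= incl g x /\ (before T p x -> c x <= incl g x)}).
Context (C_gt0 : 0 < C).
Context (mass_C :
  forall u, (mass (reach b) (TX_val u) <= (C * `|u|)%:E)%E).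

(** The normalized indicators of the cells span in TX a copy of l^1; this set is
    modelled on the positive face of its unit sphere, but its elements are not
    required to be step functions, which makes it closed at little cost. *)
Definition simplex : set E := [set u |
  {ae @leb_on R i, forall t, 0 <= TX_val u t /\ (~ D t -> TX_val u t = 0)} /\
  mass D (TX_val u) = 1%E].

Lemma mass_D_le u : (mass D (TX_val u) <= (C * `|u|)%:E)%E.
Proof.
apply: le_trans (mass_C u); apply: mass_subset.
- exact: measurable_support.
- exact: measurable_reach.
- by move=> t [n _] /cell_reach.
- exact: reach_dom.
Qed.

Lemma mass_D_fin u : mass D (TX_val u) \is a fin_num.
Proof.
rewrite ge0_fin_numE; last by apply: mass_ge0; exact: support_dom.
exact: le_lt_trans (mass_D_le u) (ltry _).
Qed.

Lemma mass_cell_fin n u : mass (ch n) (TX_val u) \is a fin_num.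
Proof.
rewrite ge0_fin_numE; last by apply: mass_ge0; exact: cell_dom.
apply: le_lt_trans (le_lt_trans (mass_D_le u) (ltry _)).
apply: mass_subset.
- exact: measurable_cell.
- exact: measurable_support.
- exact: bigcup_sup.
- exact: support_dom.
Qed.

(** Nothing is met before p, and at most the mass 1 afterwards, so that T|f| is
    at most c cut down to the points after p, which is dominated by g. *)
Lemma TX_of_mass_le1 f :
  {ae @leb_on R i, forall t, ~ D t -> f t = 0} -> (mass D f <= 1)%E ->
  exists2 u : E, TX_val u = f & `|u| <= `|g|.
Proof.
move=> fD f1; apply: TX_dominated.
have /ae_leb_onP gP := tail_g; apply/ae_leb_onP.
apply: filterS gP => x + Ix => /(_ Ix)[g0 gc]; rewrite hardyE//.
rewrite (mass_reach_support _ _ fD).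
have [px|npx] := boolP (before T p x).
  apply: (@le_trans _ _ (prefactor T w x)%:E); last by rewrite lee_fin gc.
  rewrite -[leRHS]mule1 lee_pmul2l ?lte_fin ?prefactor_gt0//.
  apply: le_trans f1; rewrite mass_D_support; apply: lee_nneseries => [n _ _|n _].
    by apply: mass_ge0 => t [_ /cell_dom].
  apply: mass_subset.
  - by apply: measurableI; [exact: measurable_reach|exact: measurable_cell].
  - exact: measurable_cell.
  - exact: subIsetr.
  - exact: cell_dom.
rewrite eseries0 ?mule0 ?lee_fin// => n _ _.
rewrite (_ : _ `&` _ = set0) ?mass_set0//.
rewrite -subset0 => t [[_ tx] nt]; case/negP: npx.
exact: before_trans (cell_start nt) tx.
Qed.

(** The values of k (S u) on the cells, S being the shift; there is no mass to
    bring to the cell 0. *)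
Definition shifted u n : R :=
  if n is m.+1 then fine (mass (ch m) (TX_val u)) / len ch n else 0.

Lemma shifted_ge0 u n : 0 <= shifted u n.
Proof.
case: n => [//|n] /=; apply: divr_ge0; last by rewrite ltW// len_gt0.
by apply: fine_ge0; apply: mass_ge0; exact: cell_dom.
Qed.

Lemma shifted_len u n :
  (shifted u n.+1 * len ch n.+1)%:E = mass (ch n) (TX_val u).
Proof. by rewrite /= divfK ?gt_eqF ?len_gt0// fineK// mass_cell_fin. Qed.

Lemma mass_cell_shifted0 u : mass (ch 0%N) (step w ch (shifted u)) = 0%E.
Proof. by rewrite mass_cell_step normr0 mul0r. Qed.

Lemma mass_cell_shiftedS u n :
  mass (ch n.+1) (step w ch (shifted u)) = mass (ch n) (TX_val u).
Proof. by rewrite mass_cell_step ger0_norm ?shifted_ge0// shifted_len. Qed.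

Lemma exists_flow u : exists v : E, TX_val v = step w ch (shifted u).
Proof.
 have [|v vE _] := @TX_mass_le _ _ X T w (step w ch (shifted u)) u.
  move=> x _; apply: transport_forward => // n.
  by rewrite ger0_norm ?shifted_ge0// shifted_len.
by exists v.
Qed.

(** The series of the masses of S u is that of u preceded by a zero term. *)
Lemma flow_simplex u v : TX_val v = step w ch (shifted u) ->
  simplex u -> simplex v.
Proof.
move=> vE [_ u1]; split; rewrite vE.
  by apply: filterS2 (step_ge0 w ch (shifted_ge0 u)) (stepE w ch (shifted u))
    => t ? [].
rewrite -u1 !mass_D_support nneseries_recl//; last first.
  by move=> n _; apply: mass_ge0; exact: cell_dom.
rewrite mass_cell_shifted0 [LHS]add0e -(nneseries_addn 1); last first.
  by move=> n; apply: mass_ge0; exact: cell_dom.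
by apply: eq_eseriesr => n _; rewrite addn1 mass_cell_shiftedS.
Qed.

Lemma fine_mass_dist n u v :
  ((`|fine (mass (ch n) (TX_val u)) - fine (mass (ch n) (TX_val v))|)%:E
    <= mass (ch n) (TX_val (u - v)%R))%E.
Proof.
exact: mass_dist (measurable_cell ch n) (@cell_dom _ _ _ _ _ ch n)
  (mass_cell_fin n u) (mass_cell_fin n v).
Qed.

(** Step functions depend linearly on their values, and the masses of u and v on
    a cell differ by at most the mass of u - v: so |S u - S v| is obtained from
    |u - v| by losing and delaying mass. *)
Lemma flow_nonexpansive (S : E -> E) :
  (forall u, TX_val (S u) = step w ch (shifted u)) ->
  forall u v, `|S u - S v| <= `|u - v|.
Proof.
move=> SE u v.
have SuvE : TX_val (S u - S v) = step w ch (fun n => shifted u n - shifted v n).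
  by rewrite step_sub -!SE.
have [|z zE] := @TX_mass_le _ _ X T w (TX_val (S u - S v)) (u - v).
  move=> x _; rewrite SuvE; apply: transport_forward => [|n]; first exact: subrr.
  rewrite /= -mulrBl normrM normfV (gtr0_norm (len_gt0 ch _)).
  rewrite divfK ?gt_eqF ?len_gt0//; exact: fine_mass_dist.
by rewrite (_ : z = S u - S v)//; exact/val_inj.
Qed.

Lemma flow_fixed_point_free u : simplex u ->
  TX_val u <> step w ch (shifted u).
Proof.
move=> [_ u1] uE.
have u0 n : mass (ch n) (TX_val u) = 0%E.
  elim: n => [|n IHn]; rewrite uE; first exact: mass_cell_shifted0.
  by rewrite mass_cell_shiftedS.
move: u1; rewrite mass_D_support eseries0//.
by move=> /eqP; rewrite eq_sym onee_eq0.
Qed.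

Lemma simplex_nonempty : simplex !=set0.
Proof.
pose r n : R := if n is 0%N then (len ch 0)^-1 else 0.
have r0 n : 0 <= r n by case: n => //=; rewrite invr_ge0 ltW ?len_gt0.
have r1 : mass D (step w ch r) = 1%E.
  rewrite mass_D_support nneseries_recl//; last first.
    by move=> n _; apply: mass_ge0; exact: cell_dom.
  rewrite mass_cell_step (ger0_norm (r0 _)) mulVf ?gt_eqF ?len_gt0//.
  rewrite eseries0 ?adde0// => -[//|n] _ _.
  by rewrite mass_cell_step normr0 mul0r.
have rD : {ae @leb_on R i, forall t, ~ D t -> step w ch r t = 0}.
  by apply: filterS (stepE w ch r) => t [].
have [|u uE _] := TX_of_mass_le1 rD; first by rewrite r1.
exists u; split; rewrite uE//.
exact: filterI (step_ge0 w ch r0) rD.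
Qed.

Lemma simplex_bounded : bounded_set simplex.
Proof.
exists `|g|; split; first exact: num_real.
move=> M gM u [uD u1]; apply: le_trans (ltW gM).
have [| |v vE vg] := @TX_of_mass_le1 (TX_val u).
- by apply: filterS uD => t [].
- by rewrite u1.
by rewrite (_ : u = v)//; apply/val_inj.
Qed.

Lemma simplex_convex : convex_set simplex.
Proof.
apply/convex_setW => u v /set_mem[uD u1] /set_mem[vD v1] t t0 t1.
have t'0 : 0 <= 1 - t%:num by rewrite subr_ge0.
have uvE : TX_val (t%:num *: u + (1 - t%:num) *: v) =
  t%:num *: TX_val u + (1 - t%:num) *: TX_val v by [].
apply/mem_set; split; rewrite [TX_val _]uvE.
  have /ae_leb_onP DE :=
    L0_addE (t%:num *: TX_val u) ((1 - t%:num) *: TX_val v).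
  have /ae_leb_onP uE := L0_scaleE t%:num (TX_val u).
  have /ae_leb_onP vE := L0_scaleE (1 - t%:num) (TX_val v).
  move/ae_leb_onP : uD => uD; move/ae_leb_onP : vD => vD; apply/ae_leb_onP.
  apply: filterS3 DE (filterI uE vE) (filterI uD vD) => x + [+ +] [+ +] Ix.
  move=> /(_ Ix) -> /(_ Ix) -> /(_ Ix) -> /(_ Ix)[ux ux0] /(_ Ix)[vx vx0].
  split; first by rewrite addr_ge0// mulr_ge0// ltW.
  by move=> nDx; rewrite ux0// vx0// !mulr0 addr0.
rewrite mass_convex//; last first.
- by apply: filterS vD => x [].
- by apply: filterS uD => x [].
- exact: support_dom.
- exact: measurable_support.
by rewrite u1 v1 !mule1 -EFinD addrC subrK.
Qed.

(** The function f - |f| 1_D, which is 0 exactly when f is nonnegative and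
    vanishes off D. *)
Lemma exists_defect f : exists f' : L0 R i, {ae @leb_on R i, forall t,
  (D t -> f' t = f t - `|f t|) /\ (~ D t -> f' t = f t)}.
Proof.
pose v := fun t : lebR R => f t - ((fun s => `|f s|) \_ D) t.
have mv : measurable_fun setT v.
  apply: measurable_funB; first exact: measurable_L0.
  apply/(measurable_restrictT _ (measurable_support ch)).1.
  by apply: measurableT_comp; [exact: normr_measurable|exact: measurable_L0].
exists (toL0 (@leb_on R i) (mfun_Sub (mem_set mv))).
apply: filterS (@toL0K _ _ _ (@leb_on R i) (mfun_Sub (mem_set mv))) => t ->.
rewrite /= /v patchE; split=> [Dt|nDt]; first by rewrite mem_set.
by rewrite memNset// subr0.
Qed.

(** The two constraints are closed: the mass is continuous, and the defect
    f' = u - |u| 1_D satisfies |f'| <= 2 |u - h| for each h in the simplex, since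
    h = |h| 1_D and u |-> |u| 1_D is 1-Lipschitz pointwise; so f' = 0 for u in
    the closure. *)
Lemma simplex_closed : closed simplex.
Proof.
move=> u clu.
have near_simplex e : 0 < e -> exists2 h, simplex h & `|u - h| < e.
  move=> e0; have [h [hK]] := clu _ (nbhsx_ballx u e e0).
  by rewrite -ball_normE /= => uh; exists h.
have [f' f'E] := exists_defect (TX_val u).
split; last first.
  apply/eqP; rewrite -[X in X == _]fineK ?mass_D_fin// eqe.
  rewrite -subr_eq0 -normr_le0; apply/ler_addgt0Pr => e e0; rewrite add0r.
  have [h [_ h1] uh] := near_simplex (e / C) (divr_gt0 e0 C_gt0).
  rewrite -lee_fin -[X in fine _ - X]/(fine 1%E) -h1.
  apply: le_trans (mass_dist (measurable_support ch) (@support_dom _ _ _ _ _ ch)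
    (mass_D_fin u) (mass_D_fin h)) _.
  apply: le_trans (mass_D_le (u - h)) _.
  by rewrite lee_fin mulrC -ler_pdivlMr// ltW.
have f'_le e : 0 < e -> exists2 v : E, TX_val v = f' & `|v| <= e.
  move=> e0; have e20 : 0 < e / 2 by rewrite divr_gt0.
  have [h [hD _] uh] := near_simplex _ e20.
  have [|v vE vle] := @TX_ideal _ _ X T w f' (2 *: (u - h)).
    have /ae_leb_onP E1 := L0_scaleE 2 (TX_val u - TX_val h).
    have /ae_leb_onP E2 := L0_addE (TX_val u) (- TX_val h).
    have /ae_leb_onP E3 := L0_oppE (TX_val h).
    move/ae_leb_onP : f'E => f'E; move/ae_leb_onP : hD => hD; apply/ae_leb_onP.
    apply: filterS3 (filterI E1 E2) E3 (filterI f'E hD) => t [+ +] + [+ +] It.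
    move=> /(_ It) -> /(_ It) -> /(_ It) -> /(_ It)[f'D f'nD] /(_ It)[h0 hnD].
    rewrite normrM ger0_norm//.
    have [Dt|nDt] := pselect (D t); last first.
      by rewrite f'nD// hnD// subr0 mulr_natl mulr2n lerDl.
    rewrite f'D// -[X in `|X| <= _](_ : (TX_val u t - TX_val h t) +
      (`|TX_val h t| - `|TX_val u t|) = _); last by rewrite ger0_norm//; lra.
    rewrite mulr_natl mulr2n (le_trans (ler_normD _ _))// lerD2l distrC.
    exact: ler_dist_dist.
  exists v => //; apply: le_trans vle _.
  by rewrite normrZ ger0_norm// -ler_pdivlMl// mulrC ltW.
have f'0 : f' = 0.
  have [v vE _] := f'_le 1 ltr01; rewrite -vE; suff -> : v = 0 by [].
  apply/eqP; rewrite -normr_le0; apply/ler_addgt0Pr => e /f'_le[v' v'E v'e].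
  by rewrite add0r (_ : v = v')//; apply/val_inj; rewrite /= v'E.
move/ae_leb_onP : f'E; rewrite f'0 => f'E.
have /ae_leb_onP zE := @L0_zeroE _ _ _ (@leb_on R i).
apply/ae_leb_onP; apply: filterS2 f'E zE => t + + It.
move=> /(_ It)[uD unD] /(_ It) z0; rewrite z0 in uD unD.
have [Dt|nDt] := pselect (D t); last by rewrite -unD.
by split=> //; have /eqP := uD Dt; rewrite eq_sym subr_eq0 => /eqP ->.
Qed.

Lemma flow_no_fpp : ~ fixed_point_property E.
Proof.
move=> fpp; have [S SE] := choice exists_flow.
have [||u uK Su] := fpp simplex simplex_nonempty simplex_closed simplex_bounded
    simplex_convex S.
- by move=> u; apply: flow_simplex.
- by move=> u v _ _; exact: flow_nonexpansive.
by apply: (flow_fixed_point_free uK); rewrite -SE Su.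
Qed.

End flow.

Theorem theorem8p3 (R : realType) (i : domain) (X : banach_function_space R i)
    (w : weight R i) (T : hardy_op) :
  (exists f : TX X T w, f != 0) -> ~ fixed_point_property (TX X T w).
Proof.
move=> /prefactor_tail_dominated[p [q [Ip Iq pq bpq [g gP]]]].
have [Ib bpb bbq pb bq] := midpoint_before Ip Iq bpq pq.
have [C C0 CP] := mass_bounded Ip Ib Iq bpb bbq bq gP.
exact: (flow_no_fpp (harmonic_chain Ip Ib bpb pb) gP C0 CP).
Qed.
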